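(* Let $f:\mathbb{R}^d\times\mathbb{R}^d\times\mathbb{R}^m\to[0,+\infty)$ be a Borel function, $1$-periodic in $x$, satisfying the growth assumptions listed in the context. Assume in addition that $f$ is independent of the vertical variables, i.e. $f(x,\xi,z)=f((x_\alpha,0),(\xi_\alpha,0),z)=:f(x_\alpha,\xi_\alpha,z)$, and that $f(x_\alpha,\xi_\alpha,\cdot)$ is convex for every $x_\alpha,\xi_\alpha\in\mathbb{R}^{d-1}$. For $M\in\mathbb{R}^{m\times(d-1)}$ let $$f^\infty_{\rm hom}(M)=\inf_{u\in\mathcal{D}^\#_M(Q_1)}\int_{\mathbb{R}^d}\int_{Q_1\times I_1(\xi_d)}f(x_\alpha,\xi_\alpha,u(x+\xi)-u(x))\,dx\,d\xi,$$ the homogenized density of the energies $$F_{\varepsilon,\gamma}(v)=\Big(\frac{\varepsilon}{\gamma^2}\vee\frac1\gamma\Big)\int_{\mathbb{R}^d}\int_{\{x\in\Omega^\gamma:\,x+\varepsilon\xi\in\Omega^\gamma\}}f\Big(\frac x\varepsilon,\xi,\frac{v(x+\varepsilon\xi)-v(x)}{\varepsilon}\Big)dx\,d\xi,\qquad v\in L^p(\Omega^\gamma;\mathbb{R}^m),$$ in the regime $\lim_{\varepsilon\to0}\varepsilon/\gamma=+\infty$, which is assumed. Then, for every $M\in\mathbb{R}^{m\times(d-1)}$, $$f^\infty_{\rm hom}(M)=4\inf_{w\in\mathcal{D}^\#_{\alpha,M}(Q_1)}\int_{\mathbb{R}^{d-1}}\int_{Q_1}f(x_\alpha,\xi_\a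lpha,w(x_\alpha+\xi_\alpha)-w(x_\alpha))\,dx_\alpha\,d\xi_\alpha.$$
   Context: Fix integers $d\ge2$, $m\ge1$ and $p\in(1,\infty)$. For $x\in\mathbb{R}^d$ write $x=(x_\alpha,x_d)$, $x_\alpha\in\mathbb{R}^{d-1}$. $I=(-1,1)$, $I_1(\xi_d)=\{t\in I:t+\xi_d\in I\}$, $B_r=\{y\in\mathbb{R}^{d-1}:|y|<r\}$, $C_r=B_r\times(-r,r)$, $Q_1=(0,1)^{d-1}$, $a\vee b=\max\{a,b\}$; $\omega\subset\mathbb{R}^{d-1}$ is open, bounded, with Lipschitz boundary, $\varepsilon\in(0,1)$, $\gamma=\gamma(\varepsilon)\in(0,1)$, $\Omega^\gamma=\omega\times(-\gamma,\gamma)$. ''$1$-periodic in $x$'' means invariant under $x\mapsto x+k$, $k\in\mathbb{Z}^d$. Growth assumptions: for some constants $c_2>c_1>0$ and measurable $\psi,\rho:\mathbb{R}^d\to[0,+\infty)$, $$c_1(\psi(\xi)|z|^p-\rho(\xi))\le f(x,\xi,z)\le c_2(\psi(\xi)|z|^p+\rho(\xi))\quad\text{for all }x,\xi\in\mathbb{R}^d,\ z\in\mathbb{R}^m,$$ where: $\psi(\xi)\ge c_0$ for $\xi\in C_{r_0}$, for some $r_0,c_0>0$; $\int_{\mathbb{R}^d}(\psi(\xi)|\xi|^p+\rho(\xi))\,d\xi<+\infty$; $\sup_{|\xi_d|<2}\int_{\mathbb{R}^{d-1}}(\psi(\xi_\alpha,\xi_d)|(\xi_\alpha,\xi_d)|^p+\rho(\xi_\alpha,\xi_d))\,d\xi_\alpha<+\infty$;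 and for every $\eta>0$ there is $r_\eta>0$ with $\sup_{|\xi_d|<2}\int_{\mathbb{R}^{d-1}\setminus B_{r_\eta}}(\psi(\xi_\alpha,\xi_d)|(\xi_\alpha,\xi_d)|^p+\rho(\xi_\alpha,\xi_d))\,d\xi_\alpha<\eta$. For $M\in\mathbb{R}^{m\times(d-1)}$: $\mathcal{D}^\#_M(Q_1)=\{u\in L^p_{\rm loc}(\mathbb{R}^d;\mathbb{R}^m):u(x)-Mx_\alpha\text{ is invariant under translations by }\mathbb{Z}^{d-1}\times\{0\}\}$ and $\mathcal{D}^\#_{\alpha,M}(Q_1)=\{w\in L^p_{\rm loc}(\mathbb{R}^{d-1};\mathbb{R}^m):w(x_\alpha)-Mx_\alpha\text{ is }\mathbb{Z}^{d-1}\text{-periodic}\}$.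
   Formalization: Independence of the vertical variables is required only for |ξ_d|<2 (the only range entering f^∞_hom), because independence for all ξ_d contradicts the growth assumptions, in particular integrability of ψ|ξ|^p+ρ over R^d together with the lower bound on C_{r_0}. *)

(* Defs.v *)
From HB Require Import structures.
From mathcomp Require Import all_boot all_order all_algebra.
From mathcomp Require Import all_classical all_reals all_analysis.
From mathcomp Require Import measurable_realfun.

Set Implicit Arguments.
Unset Strict Implicit.
Unset Printing Implicit Defensive.

Import Order.TTheory GRing.Theory Num.Theory.
Import numFieldNormedType.Exports.

Local Open Scope classical_set_scope.
Local Open Scope ring_scope.

(* The sigma-algebra on matrices generated by the entries; for real entries it
   is the Borel one. *)
Definition mx_display : measure_display -> measure_display.
Proof. exact. Qed.

Section matrix_measurable.
Context {R : realType} (m n : nat).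

Definition mx_measurable : set (set 'M[R]_(m, n)) :=
  <<s [set A | exists i j, exists2 B : set R,
         measurable B & A = (fun x : 'M[R]_(m, n) => x i j) @^-1` B] >>.

Let mx_measurable0 : mx_measurable set0.
Proof. exact: sigma_algebra0. Qed.

Let mx_measurableC A : mx_measurable A -> mx_measurable (~` A).
Proof. exact: sigma_algebraC. Qed.

Let mx_measurable_bigcup (F : (set 'M[R]_(m, n))^nat) :
  (forall i, mx_measurable (F i)) -> mx_measurable (\bigcup_i F i).
Proof. exact: sigma_algebra_bigcup. Qed.

HB.instance Definition _ := @isMeasurable.Build (mx_display default_measure_display)
  'M[R]_(m, n) mx_measurable mx_measurable0 mx_measurableC mx_measurable_bigcup.

Lemma measurable_mx_entry i j :
  measurable_fun setT (fun x : 'M[R]_(m, n) => x i j).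
Proof.
move=> _ B mB; rewrite setTI; apply: sub_sigma_algebra.
by exists i, j; exists B.
Qed.

Lemma measurable_fun_mx d (T : measurableType d) (g : T -> 'M[R]_(m, n)) :
  (forall i j, measurable_fun setT (fun t => g t i j)) -> measurable_fun setT g.
Proof.
move=> mg; apply: (measurability [set A | exists i j, exists2 B : set R,
  measurable B & A = (fun x : 'M[R]_(m, n) => x i j) @^-1` B]) => //.
move=> _ [_ [i [j [B mB ->]]] <-].
by rewrite -comp_preimage; exact: mg.
Qed.

End matrix_measurable.

(* The library's lebesgue_measure lives on measurableTypeR R, whose display
   differs from that of the canonical Borel structure on R and which does not
   mix with products; lebesgueR is the same measure on the canonical one. *)
Section lebesgueR.
Context {R : realType}.

Definition lebesgueR : set R -> \bar R := lebesgue_measure.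

Let lebesgueR0 : lebesgueR set0 = 0%E.
Proof. exact: (measure0 (@lebesgue_measure R)). Qed.

Let lebesgueR_ge0 A : (0 <= lebesgueR A)%E.
Proof. exact: (measure_ge0 (@lebesgue_measure R)). Qed.

Let lebesgueR_sigma_additive : semi_sigma_additive lebesgueR.
Proof. exact: (@measure_semi_sigma_additive _ _ _ (@lebesgue_measure R)). Qed.

HB.instance Definition _ := isMeasure.Build _ R _ lebesgueR
  lebesgueR0 lebesgueR_ge0 lebesgueR_sigma_additive.

Let lebesgueR_sigma_finite : sigma_finite [set: R] lebesgueR.
Proof. exact: (sigma_finiteT (@lebesgue_measure R)). Qed.

HB.instance Definition _ := Measure_isSigmaFinite.Build _ R _
  lebesgueR lebesgueR_sigma_finite.

End lebesgueR.

(* m1 \x m2 as a sigma-finite measure: the library registers only the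
   sub-probability instance for canonical inference. *)
Section sf_product.
Context d1 d2 (T1 : measurableType d1) (T2 : measurableType d2) (R : realType).
Variables (m1 : {sigma_finite_measure set T1 -> \bar R})
          (m2 : {sigma_finite_measure set T2 -> \bar R}).

Definition sf_product : set (T1 * T2) -> \bar R := (m1 \x m2)%E.

HB.instance Definition _ := Measure.on sf_product.

Let sf_product_sigma_finite : sigma_finite setT sf_product.
Proof.
have /sigma_finiteP[F [TF ndF Foo]] := sigma_finiteT m1.
have /sigma_finiteP[G [TG ndG Goo]] := sigma_finiteT m2.
exists (fun n => F n `*` G n).
  rewrite -setXTT TF TG predeqE => -[x y]; split.
    move=> [/= [n _ Fnx] [k _ Gky]]; exists (maxn n k) => //; split.
    - by move: x Fnx; exact/subsetPset/ndF/leq_maxl.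
    - by move: y Gky; exact/subsetPset/ndG/leq_maxr.
  by move=> [n _ []/= ? ?]; split; exists n.
move=> k; have [? ?] := Foo k; have [? ?] := Goo k.
split; first exact: measurableX.
by rewrite /sf_product product_measure1E// lte_mul_pinfty// ge0_fin_numE.
Qed.

HB.instance Definition _ := Measure_isSigmaFinite.Build _ _ _ sf_product
  sf_product_sigma_finite.

End sf_product.

Section lebesgue_cons.
Context {R : realType} (n : nat).

Definition rV_cons (q : R * 'rV[R]_n) : 'rV[R]_n.+1 := row_mx q.1%:M q.2.

Lemma measurable_rV_cons : measurable_fun setT rV_cons.
Proof.
apply: measurable_fun_mx => i j; rewrite ord1 /rV_cons.
case: (@split_ordP 1 n j) => k ->.
  apply: (eq_measurable_fun fst) => //= q _.
  by rewrite ord1 (@row_mxEl _ 1 1 n) mxE eqxx.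
apply: (eq_measurable_fun (fun q : R * 'rV[R]_n => q.2 0 k)).
  by move=> q _ /=; rewrite (@row_mxEr _ 1 1 n).
exact: (measurableT_comp (measurable_mx_entry 0 k)).
Qed.

Lemma measurable_rV_uncons : measurable_fun setT
  (fun v : 'rV[R]_n.+1 => (v 0 0, @rsubmx R 1 1 n v)).
Proof.
apply/measurable_fun_pairP; split => /=; first exact: measurable_mx_entry.
apply: measurable_fun_mx => i j.
apply: (eq_measurable_fun (fun v : 'rV[R]_n.+1 => v i (rshift 1 j))).
  by move=> v _ /=; rewrite mxE.
exact: measurable_mx_entry.
Qed.

Lemma rV_consK (q : R * 'rV[R]_n) :
  (rV_cons q 0 0, @rsubmx R 1 1 n (rV_cons q)) = q.
Proof.
case: q => a y; rewrite /rV_cons row_mxKr /=; congr pair.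
have -> : 0 = lshift n (0 : 'I_1) :> 'I_(1 + n) by apply/val_inj.
by rewrite (@row_mxEl _ 1 1 n) mxE eqxx.
Qed.

Context (mu : {sigma_finite_measure set 'rV[R]_n -> \bar R}).

Definition lebesgue_cons : set 'rV[R]_n.+1 -> \bar R :=
  pushforward (sf_product lebesgueR mu) rV_cons.

Let lebesgue_cons0 : lebesgue_cons set0 = 0%E.
Proof. by apply: measure0; exact: measurable_rV_cons. Qed.

Let lebesgue_cons_ge0 A : (0 <= lebesgue_cons A)%E.
Proof. by apply: measure_ge0; exact: measurable_rV_cons. Qed.

Let lebesgue_cons_sigma_additive : semi_sigma_additive lebesgue_cons.
Proof.
by apply: measure_semi_sigma_additive; exact: measurable_rV_cons.
Qed.

HB.instance Definition _ := isMeasure.Build _ _ _ lebesgue_cons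
  lebesgue_cons0 lebesgue_cons_ge0 lebesgue_cons_sigma_additive.

Let lebesgue_cons_sigma_finite : sigma_finite setT lebesgue_cons.
Proof.
have [F FT Foo] := sigma_finiteT (sf_product (@lebesgueR R) mu).
exists (fun k => (fun v : 'rV[R]_n.+1 => (v 0 0, @rsubmx R 1 1 n v)) @^-1` F k).
  by rewrite -preimage_bigcup -FT preimage_setT.
move=> k; have [mF Fk] := Foo k; split.
  by rewrite -[X in measurable X]setTI; exact: measurable_rV_uncons.
rewrite /lebesgue_cons /pushforward -comp_preimage.
rewrite (_ : _ \o _ = id); first by rewrite preimage_id.
by apply/funext => q; exact: rV_consK.
Qed.

HB.instance Definition _ := Measure_isSigmaFinite.Build _ _ _
  lebesgue_cons lebesgue_cons_sigma_finite.

End lebesgue_cons.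

Fixpoint lebesgue_rV (R : realType) (n : nat) :
    {sigma_finite_measure set 'rV[R]_n -> \bar R} :=
  if n is k.+1 then lebesgue_cons (lebesgue_rV R k) else \d_(0 : 'rV[R]_0).

(* R^d as R^(d-1) * R, with x = (x_alpha, x_d). *)
Notation Rd R d := ('rV[R]_d.-1 * R)%type.

Definition lebesgue_Rd (R : realType) (d : nat) :
    {sigma_finite_measure set (Rd R d) -> \bar R} :=
  sf_product (lebesgue_rV R d.-1) (@lebesgueR R).

Section definitions.
Context {R : realType}.

(* The norms the library puts on matrices and on products are sup norms, hence
   these two. *)
Definition enorm n (z : 'rV[R]_n) : R := Num.sqrt (\sum_i z 0 i ^+ 2).

Definition enormRd d (x : Rd R d) : R :=
  Num.sqrt (\sum_i x.1 0 i ^+ 2 + x.2 ^+ 2).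

Definition eball n (r : R) : set 'rV[R]_n := [set y | enorm y < r].

Definition cylinder d (r : R) : set (Rd R d) :=
  [set x | enorm x.1 < r /\ - r < x.2 < r].

Definition Q1 n : set 'rV[R]_n := [set y | forall i, 0 < y 0 i < 1].

Definition Iunit : set R := `]-1, 1[.

Definition I1 (t : R) : set R := [set s | Iunit s /\ Iunit (s + t)].

Definition horizontal d (x : Rd R d) : Rd R d := (x.1, 0).

Definition zvec n (k : 'rV[int]_n) : 'rV[R]_n := map_mx intr k.

Section integrand.
Context {d m : nat}.
Implicit Types (f : Rd R d -> Rd R d -> 'rV[R]_m -> R) (p : R).

Definition borel3 f : Prop :=
  measurable_fun setT
    (fun q : (Rd R d * Rd R d) * 'rV[R]_m => f q.1.1 q.1.2 q.2).

Definition periodic1 f : Prop :=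
  forall (k : 'rV[int]_d.-1) (l : int) x xi z,
    f (x + (zvec k, l%:~R)) xi z = f x xi z.

Definition growth p f : Prop :=
  exists (c1 c2 : R) (psi rho : Rd R d -> R),
    let g (xi : Rd R d) : \bar R :=
      (psi xi * enormRd xi `^ p + rho xi)%:E in
    [/\ 0 < c1 < c2,
        measurable_fun setT psi /\ (forall xi, 0 <= psi xi),
        measurable_fun setT rho /\ (forall xi, 0 <= rho xi),
        (forall x xi z,
          c1 * (psi xi * enorm z `^ p - rho xi) <= f x xi z
            <= c2 * (psi xi * enorm z `^ p + rho xi)) &
    [/\ exists r0 c0 : R, [/\ 0 < r0, 0 < c0 &
          forall xi, cylinder r0 xi -> c0 <= psi xi],
        (\int[lebesgue_Rd R d]_xi g xi < +oo)%E,
        (ereal_sup [set \int[lebesgue_rV R d.-1]_a g (a, t)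
                   | t in [set t : R | (`|t| < 2)%R]] < +oo)%E &
        forall eta : R, 0 < eta -> exists2 r : R, 0 < r &
          (ereal_sup [set \int[lebesgue_rV R d.-1]_(a in ~` eball r) g (a, t)
                     | t in [set t : R | (`|t| < 2)%R]] < eta%:E)%E]].

(* The condition is imposed for |xi_d| < 2 only. Two points of a slab of height
   2 differ vertically by less than 2, so no other xi enters the energies or
   the cell formula. Imposed for every xi_d it would contradict [growth]: the
   integrability of psi |xi|^p + rho over R^d makes the upper bound integrable
   in xi_d at infinity, so f(x_alpha, xi_alpha, z) would vanish for almost every
   xi_alpha, against the lower bound on the cylinder. *)
Definition vertically_independent f : Prop :=
  forall x xi z, `|xi.2| < 2 -> f x xi z = f (horizontal x) (horizontal xi) z.

Definition horizontally_convex f : Prop :=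
  forall a b : 'rV[R]_d.-1,
    convex_function [set: convex_lmodType 'rV[R]_m] (f (a, 0) (b, 0)).

(* Elements of L^p_loc are represented by Borel functions, so that translation
   invariance is understood almost everywhere. With row vectors, M x_alpha is
   x_alpha *m M^T. *)
Definition Lploc_Rd p : set (Rd R d -> 'rV[R]_m) :=
  [set u | measurable_fun setT u /\
    forall K : set (Rd R d), compact K ->
      (\int[lebesgue_Rd R d]_(x in K) (enorm (u x) `^ p)%:E < +oo)%E].

Definition Lploc_rV p : set ('rV[R]_d.-1 -> 'rV[R]_m) :=
  [set w | measurable_fun setT w /\
    forall K : set 'rV[R]_d.-1, compact K ->
      (\int[lebesgue_rV R d.-1]_(a in K) (enorm (w a) `^ p)%:E < +oo)%E].

Definition Dper p (M : 'M[R]_(m, d.-1)) : set (Rd R d -> 'rV[R]_m) :=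
  [set u | Lploc_Rd p u /\ forall k : 'rV[int]_d.-1,
    {ae lebesgue_Rd R d, forall x,
      u (x + (zvec k, 0)) - (x + (zvec k, 0)).1 *m M^T = u x - x.1 *m M^T}].

Definition Dper_alpha p (M : 'M[R]_(m, d.-1)) :
    set ('rV[R]_d.-1 -> 'rV[R]_m) :=
  [set w | Lploc_rV p w /\ forall k : 'rV[int]_d.-1,
    {ae lebesgue_rV R d.-1, forall a,
      w (a + zvec k) - (a + zvec k) *m M^T = w a - a *m M^T}].

Definition fhom_infty p f (M : 'M[R]_(m, d.-1)) : \bar R :=
  ereal_inf [set
    (\int[lebesgue_Rd R d]_xi
       \int[lebesgue_Rd R d]_(x in @Q1 d.-1 `*` I1 xi.2)
         (f (horizontal x) (horizontal xi) (u (x + xi) - u x))%:E)%E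
    | u in Dper p M].

End integrand.
End definitions.

(* Main.v *)
Require Import Defs.
From mathcomp Require Import all_boot all_order all_algebra.
From mathcomp Require Import all_classical all_reals all_analysis.
From mathcomp Require Import measurable_realfun ring lra.

Set Implicit Arguments.
Unset Strict Implicit.
Unset Printing Implicit Defensive.

Import Order.TTheory GRing.Theory Num.Theory.
Import numFieldNormedType.Exports.

Local Open Scope classical_set_scope.
Local Open Scope ring_scope.

(** The cell formula sees a field [u] on the slab of height 2 only through
differences [u (x + xi) - u x] between pairs of points of the slab, and the
integrand does not depend on their heights.  Replacing the vertical increment
[xi_d] by the height [t = x_d + xi_d] of the second point, the energy of [u] is
the integral over the horizontal variables [a] in the unit cube and [b] of the
double integral over [(s, t)] in [(-1, 1)^2] of
[f (a, b, u (a + b, t) - u (a, s))]; this is [cell_energyE].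

If [u] does not depend on the height, the double integral is the area 4 of the
square times the value of the integrand at the increment of [u]
([fibre_energy_fst]), whence one inequality, each competitor of the horizontal
problem being one of the cell problem ([Dper_fst]).

Conversely, let [w] be the mean of [u] over the vertical segments ([vmean]).
Since [f (a, b, .)] is convex, Jensen's inequality, applied in [t] for fixed [s]
and then in [s], bounds the double integral below by
[4 f (a, b, w (a + b) - w a)] ([le_fibre_energy_vmean]), and [w] is a competitor
of the horizontal problem ([vmean_Dper]).  Jensen's inequality needs [u] to be
integrable on the vertical segments over [a] and over [a + b].  This holds for
almost every [a], because [u] is locally in [L^p] and null sets of the
horizontal space are invariant under translation ([lebesgue_rV_translation]).

Jensen's inequality for vector-valued maps ([jensen_rV]) rests on the existence
of an affine minorant of a convex function that touches it at a prescribed point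
([exists_subgradient]). *)

(** * Affine minorants of convex functions *)

Section subgradient.
Context {R : realType} {m : nat}.
Implicit Types (phi : 'rV[R]_m -> R) (z : 'rV[R]_m).

Lemma convex_functionP phi :
  convex_function [set: convex_lmodType 'rV[R]_m] phi <->
  forall (t : R) x y, 0 <= t <= 1 ->
    phi (t *: x + (1 - t) *: y) <= t * phi x + (1 - t) * phi y.
Proof.
split=> [cphi t x y /andP[t0 t1]|cphi t x y _ _].
  by have := cphi (Itv01 t0 t1) x y; rewrite !in_setT => /(_ isT isT).
by apply: cphi; apply/andP; split.
Qed.

Lemma convex_function_affine phi y (k : R) :
  convex_function [set: convex_lmodType 'rV[R]_m] phi ->
  convex_function [set: convex_lmodType 'rV[R]_m] (fun z => phi (y + k *: z)).
Proof.
move=> /convex_functionP cphi; apply/convex_functionP => t z1 z2 t01.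
rewrite (le_trans _ (cphi _ _ _ t01))// le_eqVlt; apply/orP; left; apply/eqP.
congr phi; apply/rowP => i; rewrite !mxE; ring.
Qed.

(** The finite-dimensional Hahn-Banach argument, one coordinate at a time.  Given
a minorant on the span of the first [k] basis vectors, convexity says that every
left difference quotient in the next direction is at most every right one, so
that the supremum of the left ones is an admissible slope. *)
Lemma exists_subgradient_subspace phi z0 k :
  convex_function [set: convex_lmodType 'rV[R]_m] phi -> (k <= m)%N ->
  exists s : 'rV[R]_m, forall z, (forall i : 'I_m, (k <= i)%N -> z 0 i = 0) ->
    phi z0 + \sum_i s 0 i * z 0 i <= phi (z0 + z).
Proof.
move=> /convex_functionP cphi; elim: k => [_|k IH km].
  exists 0 => z z_0; rewrite big1 ?addr0.
    by rewrite (_ : z = 0) ?addr0//; apply/rowP => i; rewrite z_0// mxE.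
  by move=> i _; rewrite mxE mul0r.
have [s sP] := IH (ltnW km); pose j := Ordinal km; pose e : 'rV[R]_m := delta_mx 0 j.
pose V z := forall i : 'I_m, (k <= i)%N -> z 0 i = 0.
pose L z := \sum_i s 0 i * z 0 i.
(* The point [r (z + t e) + (1 - r) (z' - t' e)] has no [e]-component for
   [r = t' / (t + t')], so the minorant at hand applies to it. *)
have key z z' t t' : V z -> V z' -> 0 < t -> 0 < t' ->
    t * (phi z0 + L z' - phi (z0 + (z' - t' *: e))) <=
    t' * (phi (z0 + (z + t *: e)) - (phi z0 + L z)).
  move=> Vz Vz' t0 t'0.
  have tt0 : 0 < t + t' by rewrite addr_gt0.
  pose r := t' / (t + t').
  have r01 : 0 <= r <= 1.
    by rewrite divr_ge0 ?(ltW t'0) ?(ltW tt0)//= ler_pdivrMr// mul1r lerDr ltW.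
  have rE : (t + t') * r = t' by rewrite mulrC divfK// gt_eqF.
  have rE' : (t + t') * (1 - r) = t by rewrite mulrBr rE mulr1 addrK.
  have := cphi r (z0 + (z + t *: e)) (z0 + (z' - t' *: e)) r01.
  have -> : r *: (z0 + (z + t *: e)) + (1 - r) *: (z0 + (z' - t' *: e)) =
      z0 + (r *: z + (1 - r) *: z').
    have H : r * t = (1 - r) * t'.
      by rewrite -[X in _ * X = _]rE' -[X in _ = _ * X]rE; ring.
    apply/rowP => i; rewrite !mxE; set c : R := (_ && _)%:R.
    have : r * t * c = (1 - r) * t' * c by rewrite H.
    move=> H2.
    transitivity (z0 0 i + (r * z 0 i + (1 - r) * z' 0 i) +
       (r * t * c - (1 - r) * t' * c)); first by ring.
    by rewrite H2; ring.
  move=> /(le_trans (sP (r *: z + (1 - r) *: z') _)) H.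
  have {H} : phi z0 + (r * L z + (1 - r) * L z') <=
      r * phi (z0 + (z + t *: e)) + (1 - r) * phi (z0 + (z' - t' *: e)).
    rewrite (le_trans _ (H _))//.
      rewrite lerD2l le_eqVlt; apply/orP; left; apply/eqP.
      rewrite /L !mulr_sumr -big_split/=; apply: eq_bigr => i _.
      by rewrite !mxE; ring.
    by move=> i ki; rewrite !mxE Vz// Vz'// !mulr0 addr0.
  move=> H; rewrite -subr_ge0 in H; rewrite -subr_ge0.
  rewrite (le_trans (mulr_ge0 (ltW tt0) H))//; rewrite le_eqVlt; apply/orP; left; apply/eqP.
  rewrite -[X in _ = X * _ - _]rE -[X in _ = _ - X * _]rE'; ring.
(* [S] collects the left difference quotients. *)
pose S := [set r | exists z' t', [/\ V z', 0 < t' &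
  r = (phi z0 + L z' - phi (z0 + (z' - t' *: e))) / t']].
have V0 : V 0 by move=> i _; rewrite mxE.
have S0 : S !=set0 by exists ((phi z0 + L 0 - phi (z0 + (0 - 1 *: e))) / 1), 0, 1.
have Sub z t : V z -> 0 < t ->
    ubound S ((phi (z0 + (z + t *: e)) - (phi z0 + L z)) / t).
  move=> Vz t0 _ [z' [t' [Vz' t'0 ->]]].
  by rewrite ler_pdivrMr// mulrAC ler_pdivlMr// mulrC [leRHS]mulrC key.
have supS : has_sup S by split => //; exists ((phi (z0 + (0 + 1 *: e)) - (phi z0 + L 0)) / 1); exact: Sub.
pose al := sup S.
exists (\row_i if i == j then al else s 0 i) => z zk.
pose z' : 'rV[R]_m := \row_i if i == j then 0 else z 0 i.
have Vz' : V z'.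
  move=> i ki; rewrite mxE; case: eqVneq => // ij; apply: zk.
  rewrite ltn_neqAle ki andbT; apply: contra ij => /eqP kE.
  by apply/eqP/val_inj.
have zE : z = z' + z 0 j *: e.
  apply/rowP => i; rewrite !mxE eqxx/=; case: eqVneq => [->|_].
    by rewrite mulr1 add0r.
  by rewrite mulr0 addr0.
have -> : \sum_i (\row_i (if i == j then al else s 0 i)) 0 i * z 0 i =
    L z' + al * z 0 j.
  rewrite /L (bigD1 j)//= [in RHS](bigD1 j)//= !mxE eqxx mulr0 add0r addrC.
  by congr (_ + _); apply: eq_bigr => i /negbTE ij; rewrite !mxE ij.
rewrite {2}zE addrA.
have [zj0|zj0|->] := ltgtP (z 0 j) 0.
- have : (phi z0 + L z' - phi (z0 + (z' - (- z 0 j) *: e))) / (- z 0 j) <= al.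
    by apply: ub_le_sup; [case: supS|exists z', (- z 0 j); rewrite oppr_gt0].
  rewrite ler_pdivrMr ?oppr_gt0// scaleNr opprK; lra.
- have : al <= (phi (z0 + (z' + z 0 j *: e)) - (phi z0 + L z')) / z 0 j.
    by apply: ge_sup => //; exact: Sub.
  rewrite ler_pdivlMr//; lra.
- by rewrite mulr0 addr0 scale0r addr0; exact: sP.
Qed.

Lemma exists_subgradient phi z0 :
  convex_function [set: convex_lmodType 'rV[R]_m] phi ->
  exists s : 'rV[R]_m, forall z,
    phi z0 + \sum_i s 0 i * (z 0 i - z0 0 i) <= phi z.
Proof.
move=> cphi; have [s sP] := exists_subgradient_subspace z0 cphi (leqnn m).
exists s => z; have := sP (z - z0); rewrite (addrC z0) subrK => sz.
rewrite (le_trans _ (sz _))//.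
  rewrite lerD2l le_eqVlt; apply/orP; left; apply/eqP; apply: eq_bigr => i _.
  by rewrite !mxE.
by move=> i; rewrite leqNgt ltn_ord.
Qed.

End subgradient.

(** * Jensen's inequality for vector-valued maps *)

Section jensen.
Context {R : realType} {m : nat} d (T : measurableType d).
Variables (mu : {measure set T -> \bar R}) (D : set T) (c : R).
Hypotheses (mD : measurable D) (c0 : 0 < c) (muD : mu D = c%:E).

(** The affine minorant of [phi] touching it at the mean of [X] has, composed with
[X], the integral [c * phi (mean of X)]. *)
Lemma jensen_rV (X : T -> 'rV[R]_m) (phi : 'rV[R]_m -> R) :
  convex_function [set: convex_lmodType 'rV[R]_m] phi ->
  (forall z, 0 <= phi z) ->
  (forall i, mu.-integrable D (fun x => (X x 0 i)%:E)) ->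
  measurable_fun D (phi \o X) ->
  ((c * phi (\row_i (c^-1 * \int[mu]_(x in D) X x 0 i)%R))%:E
    <= \int[mu]_(x in D) (phi (X x))%:E)%E.
Proof.
move=> cphi phi0 iX mphiX; set z0 := \row_i _.
have [->|phiXoo] := eqVneq (\int[mu]_(x in D) (phi (X x))%:E)%E +oo%E.
  by rewrite leey.
have iphiX : mu.-integrable D (EFin \o (phi \o X)).
  apply/integrableP; split; first exact/measurable_EFinP.
  under eq_integral => x _ do rewrite /= ger0_norm//.
  by rewrite ltey.
have [s sP] := exists_subgradient z0 cphi.
pose k := phi z0 - \sum_i s 0 i * z0 0 i.
have icst r : mu.-integrable D (EFin \o cst r).
  apply/integrableP; split; first exact/measurable_EFinP/measurable_cst.
  rewrite (eq_integral (cst `|r|%:E)) ?integral_cst// ?muD -?EFinM ?ltry//.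
have isX i : mu.-integrable D (fun x => ((s 0 i)%:E * (X x 0 i)%:E)%E).
  exact: integrableZl.
have iS : mu.-integrable D (fun x => \sum_i ((s 0 i)%:E * (X x 0 i)%:E)%E).
  by apply: integrable_sum => // i _; exact: isX.
have -> : (c * phi z0)%:E =
    (\int[mu]_(x in D) (k%:E + \sum_i ((s 0 i)%:E * (X x 0 i)%:E)))%E.
  rewrite integralD//; last exact: icst.
  rewrite integral_cst// muD integral_sum//.
  have -> : (\sum_i \int[mu]_(x in D) ((s 0 i)%:E * (X x 0 i)%:E))%E =
      (c * \sum_i s 0 i * z0 0 i)%:E.
    rewrite mulr_sumr -sumEFin; apply: eq_bigr => i _.
    rewrite integralZl// -[X in (_ * X)%E]fineK ?integrable_fin_num//.
    rewrite -EFinM mxE; congr EFin; rewrite /Rintegral.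
    by rewrite mulrCA (mulrA c) divff ?gt_eqF// mul1r.
  by rewrite -EFinM -EFinD /k; congr EFin; ring.
apply: le_integral => //.
  by apply: (@integrableD _ _ _ mu D mD (cst k%:E)) => //; exact: icst.
move=> x; rewrite inE => Dx.
rewrite (eq_bigr (fun i => (s 0 i * X x 0 i)%:E)); last by [].
rewrite sumEFin -EFinD lee_fin (le_trans _ (sP _))// le_eqVlt; apply/orP; left.
apply/eqP; rewrite /k -addrA; congr (_ + _).
by rewrite addrC -sumrB; apply: eq_bigr => i _; rewrite mulrBr.
Qed.

End jensen.

(** * Measure-preserving maps *)

Section measure_preserving.
Context d (T : measurableType d) {R : realType}.
Variables (mu : {measure set T -> \bar R}) (g : T -> T).
Hypotheses (mg : measurable_fun setT g)
  (gmu : forall A, measurable A -> mu (g @^-1` A) = mu A).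

Lemma measurable_preimageT A : measurable A -> measurable (g @^-1` A).
Proof. by move=> mA; rewrite -[X in measurable X]setTI; exact: mg. Qed.

Lemma ge0_integral_measure_preserving (f : T -> \bar R) :
  measurable_fun setT f -> (forall x, (0 <= f x)%E) ->
  (\int[mu]_x f (g x) = \int[mu]_x f x)%E.
Proof.
move=> mf f0; rewrite -[LHS](@ge0_integral_pushforward _ _ _ _ _ g mg mu setT)//.
apply: eq_measure_integral => A mA _; exact: gmu.
Qed.

Lemma ae_measure_preserving (P : T -> Prop) :
  {ae mu, forall x, P x} -> {ae mu, forall x, P (g x)}.
Proof.
move=> [N [mN N0 PN]]; exists (g @^-1` N); split.
- exact: measurable_preimageT.
- by rewrite gmu.
- by move=> x /= nP; exact: PN.
Qed.

End measure_preserving.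

(** * Product measures *)

Section sf_product_theory.
Context d1 d2 (T1 : measurableType d1) (T2 : measurableType d2) {R : realType}.
Variables (m1 : {sigma_finite_measure set T1 -> \bar R})
          (m2 : {sigma_finite_measure set T2 -> \bar R}).

Lemma measurable_ge0_integral_section (B : set T2) (f : T1 -> T2 -> \bar R) :
  measurable B -> measurable_fun setT (fun z => f z.1 z.2) ->
  (forall x y, (0 <= f x y)%E) ->
  measurable_fun setT (fun x => \int[m2]_(y in B) f x y)%E.
Proof.
move=> mB mf f0.
rewrite (_ : (fun x => _) = fubini_F m2 ((fun z => f z.1 z.2) \_ (setT `*` B))).
  apply: measurable_fun_fubini_tonelli_F => [|z]; last exact: erestrict_ge0.
  apply/(measurable_restrict _ _ measurableT) => //; first exact: measurableX.
  exact: measurable_funS mf.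
apply/funext => x; rewrite /fubini_F [LHS]integral_mkcond; apply: eq_integral => y _.
by rewrite !patchE in_setX in_setT.
Qed.

Lemma ge0_integral_setX (A : set T1) (B : set T2) (f : T1 * T2 -> \bar R) :
  measurable A -> measurable B -> measurable_fun setT f ->
  (forall z, (0 <= f z)%E) ->
  (\int[sf_product m1 m2]_(z in A `*` B) f z =
   \int[m1]_(x in A) \int[m2]_(y in B) f (x, y))%E.
Proof.
move=> mA mB mf f0; rewrite integral_mkcond.
rewrite [LHS](@fubini_tonelli1 _ _ _ _ _ m1 m2 (f \_ (A `*` B))); last 2 first.
- apply/(measurable_restrict _ _ measurableT) => //; first exact: measurableX.
  exact: measurable_funS mf.
- by move=> z; exact: erestrict_ge0.
rewrite [RHS]integral_mkcond; apply: eq_integral => x _.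
rewrite /fubini_F [RHS]patchE; case: ifPn => xA.
  rewrite [RHS]integral_mkcond; apply: eq_integral => y _.
  by rewrite !patchE in_setX xA.
by apply: integral0_eq => y _; rewrite patchE in_setX (negbTE xA).
Qed.

Lemma ge0_integral_exchange (A : set T1) (B : set T2) (f : T1 -> T2 -> \bar R) :
  measurable A -> measurable B -> measurable_fun setT (fun z => f z.1 z.2) ->
  (forall x y, (0 <= f x y)%E) ->
  (\int[m1]_(x in A) \int[m2]_(y in B) f x y =
   \int[m2]_(y in B) \int[m1]_(x in A) f x y)%E.
Proof.
move=> mA mB mf f0; pose h := (fun z => f z.1 z.2) \_ (A `*` B).
have mh : measurable_fun setT h.
  apply/(measurable_restrict _ _ measurableT) => //; first exact: measurableX.
  exact: measurable_funS mf.
transitivity (\int[m1]_x \int[m2]_y h (x, y))%E.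
  rewrite integral_mkcond; apply: eq_integral => x _.
  rewrite patchE; case: ifPn => xA.
    rewrite integral_mkcond; apply: eq_integral => y _.
    by rewrite /h !patchE in_setX xA.
  by apply/esym/integral0_eq => y _; rewrite /h patchE in_setX (negbTE xA).
rewrite (fubini_tonelli h)//; last by move=> z; exact: erestrict_ge0.
rewrite [RHS]integral_mkcond; apply: eq_integral => y _.
rewrite [RHS]patchE; case: ifPn => yB.
  rewrite [RHS]integral_mkcond; apply: eq_integral => x _.
  by rewrite /h !patchE in_setX yB andbT.
by apply: integral0_eq => x _; rewrite /h patchE in_setX (negbTE yB) andbF.
Qed.

Lemma ae_sf_product (P : T1 * T2 -> Prop) :
  {ae sf_product m1 m2, forall z, P z} ->
  {ae m1, forall x, {ae m2, forall y, P (x, y)}}.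
Proof.
move=> [N [mN N0 PN]].
have m20 : {ae m1, forall x, setT x -> (m2 \o xsection N) x = 0%E}.
  apply/(ae_eq_integral_abs m1 measurableT).
    exact: measurable_fun_xsection.
  rewrite -[RHS]N0; apply: eq_integral => x _.
  by rewrite gee0_abs.
apply: filterS m20 => x /(_ I)/= N0x; exists (xsection N x); split => //.
  exact: measurable_xsection.
by move=> y /= nP; rewrite /xsection/= inE; exact: PN.
Qed.

Lemma ae_sf_product_fst (P : T1 -> Prop) :
  {ae m1, forall x, P x} -> {ae sf_product m1 m2, forall z, P z.1}.
Proof.
move=> [N [mN N0 PN]]; exists (N `*` setT); split.
- exact: measurableX.
- transitivity (m1 N * m2 setT)%E; last by rewrite N0 mul0e.
  exact: product_measure1E.
- by move=> z /= nP; split => //; exact: PN.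
Qed.

(** Sections of the preimage of [A] are preimages of sections of [A]. *)
Lemma sf_product_preserving (g1 : T1 -> T1) (g2 : T2 -> T2) :
  measurable_fun setT g1 -> measurable_fun setT g2 ->
  (forall A, measurable A -> m1 (g1 @^-1` A) = m1 A) ->
  (forall A, measurable A -> m2 (g2 @^-1` A) = m2 A) ->
  forall A, measurable A ->
    sf_product m1 m2 ((fun z => (g1 z.1, g2 z.2)) @^-1` A) = sf_product m1 m2 A.
Proof.
move=> mg1 mg2 g1m g2m A mA; rewrite /sf_product /product_measure1.
rewrite -[RHS](ge0_integral_measure_preserving mg1 g1m)//; last first.
  exact: measurable_fun_xsection.
apply: eq_integral => x _; rewrite [RHS]/= -g2m.
  by congr (m2 _); apply/seteqP; split => y; rewrite /xsection/= !inE.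
exact: measurable_xsection.
Qed.

End sf_product_theory.

(** * Translation invariance of Lebesgue measure *)

Section translation.
Context {R : realType}.

(** The translated measure gives half-open intervals their length, which
characterizes Lebesgue measure. *)
Lemma lebesgueR_translation (t : R) (A : set R) : measurable A ->
  lebesgueR ((fun s => s + t) @^-1` A) = lebesgueR A.
Proof.
move=> mA; pose g : measurableTypeR R -> measurableTypeR R := fun s => s + t.
have mg : measurable_fun setT g by exact: measurable_funD.
rewrite /lebesgueR -[LHS]/(pushforward lebesgue_measure g A).
apply/esym/lebesgue_measure_unique => //= _ [[a b]] _ <-.
rewrite /pushforward/= -[X in _ = _ X]/((fun s => s + t) @^-1` `]a, b]%classic).
rewrite (_ : _ @^-1` _ = `]a - t, b - t]%classic); last first.
  by apply/seteqP; split => x /=; rewrite !in_itv/= ltrBlDr lerBrDr.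
rewrite !lebesgue_measure_itv/= !lte_fin ltrD2r.
by case: ifPn => // _; rewrite -!EFinB; congr EFin; ring.
Qed.

Lemma measurable_translation n (b : 'rV[R]_n) :
  measurable_fun setT (fun a : 'rV[R]_n => a + b).
Proof.
apply: measurable_fun_mx => i j.
apply: (eq_measurable_fun (fun a : 'rV[R]_n => a i j + b i j)).
  by move=> a _; rewrite mxE.
by apply: measurable_funD => //; exact: measurable_mx_entry.
Qed.

(** Translations act coordinatewise in the decomposition of [R^(n+1)] as
[R * R^n], through which its Lebesgue measure is defined. *)
Lemma rV_cons_translation n (b : 'rV[R]_n.+1) (q : R * 'rV[R]_n) :
  rV_cons (q.1 + b 0 0, q.2 + @rsubmx R 1 1 n b) = rV_cons q + b.
Proof.
apply/rowP => j; rewrite [RHS]mxE /rV_cons; case: (@split_ordP 1 n j) => k ->.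
  rewrite !(@row_mxEl _ 1 1 n) !mxE ord1; congr (_ + b _ _).
  exact: val_inj.
by rewrite !(@row_mxEr _ 1 1 n) !mxE.
Qed.

Lemma lebesgue_rV_translation n (b : 'rV[R]_n) A : measurable A ->
  lebesgue_rV R n ((fun a => a + b) @^-1` A) = lebesgue_rV R n A.
Proof.
elim: n b A => [|n IH] b A mA.
  congr (lebesgue_rV R 0 _); apply/seteqP; split => x;
    by rewrite /= [x + b]thinmx0 [x]thinmx0.
rewrite /= /lebesgue_cons /pushforward.
rewrite -[RHS](@sf_product_preserving _ _ _ _ _ _ _ (fun s : R => s + b 0 0)
   (fun a : 'rV[R]_n => a + @rsubmx R 1 1 n b)).
- congr (sf_product _ _ _).
  by apply/seteqP; split => q /=; rewrite -rV_cons_translation.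
- exact: measurable_funD.
- exact: measurable_translation.
- exact: lebesgueR_translation.
- exact: IH.
- by rewrite -[X in measurable X]setTI; exact: measurable_rV_cons.
Qed.

Lemma ge0_integral_translation (t : R) (g : R -> \bar R) :
  measurable_fun setT g -> (forall s, (0 <= g s)%E) ->
  (\int[lebesgueR]_s g (s + t)%R = \int[lebesgueR]_s g s)%E.
Proof.
apply: (@ge0_integral_measure_preserving _ _ _ lebesgueR (fun s => s + t)).
  exact: measurable_funD.
exact: lebesgueR_translation.
Qed.

Lemma ae_rV_translation n (b : 'rV[R]_n) (P : 'rV[R]_n -> Prop) :
  {ae lebesgue_rV R n, forall a, P a} ->
  {ae lebesgue_rV R n, forall a, P (a + b)}.
Proof.
apply: (@ae_measure_preserving _ _ _ (lebesgue_rV R n) (fun a => a + b)).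
  exact: measurable_translation.
exact: lebesgue_rV_translation.
Qed.

End translation.

(** * The Euclidean norm *)

Section euclidean_norm.
Context {R : realType} {n : nat}.
Implicit Types z x y : 'rV[R]_n.

Lemma enorm_ge0 z : 0 <= enorm z.
Proof. exact: sqrtr_ge0. Qed.

Lemma sum_sqr_ge0 z : 0 <= \sum_i z 0 i ^+ 2.
Proof. by apply: sumr_ge0 => i _; exact: sqr_ge0. Qed.

Lemma ler_entry_enorm z i : `|z 0 i| <= enorm z.
Proof.
rewrite -sqrtr_sqr ler_wsqrtr// (bigD1 i)//= lerDl.
by apply: sumr_ge0 => j _; exact: sqr_ge0.
Qed.

Lemma enormZ (k : R) z : enorm (k *: z) = `|k| * enorm z.
Proof.
rewrite /enorm -sqrtr_sqr -sqrtrM ?sqr_ge0//; congr Num.sqrt.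
by rewrite mulr_sumr; apply: eq_bigr => i _; rewrite mxE exprMn.
Qed.

Lemma cauchy_schwarz_rV x y : (\sum_i x 0 i * y 0 i) <= enorm x * enorm y.
Proof.
(* The squared norm of [Y x - P y] is [Y (X Y - P^2)]. *)
pose X := \sum_i x 0 i ^+ 2; pose Y := \sum_i y 0 i ^+ 2.
pose P := \sum_i x 0 i * y 0 i.
have X0 : 0 <= X by exact: sum_sqr_ge0.
have Y0 : 0 <= Y by exact: sum_sqr_ge0.
have : 0 <= \sum_i (Y * x 0 i - P * y 0 i) ^+ 2.
  by apply: sumr_ge0 => i _; exact: sqr_ge0.
have -> : \sum_i (Y * x 0 i - P * y 0 i) ^+ 2 = Y * (X * Y - P ^+ 2).
  rewrite (eq_bigr (fun i => Y ^+ 2 * x 0 i ^+ 2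
    - (2 * Y * P * (x 0 i * y 0 i) - P ^+ 2 * y 0 i ^+ 2))); last first.
    by move=> i _; ring.
  rewrite !sumrB -!mulr_sumr -/X -/Y -/P; ring.
move: Y0; rewrite le_eqVlt => /predU1P[Y0 _|Y0].
  rewrite (_ : \sum_i _ = 0) ?mulr_ge0 ?enorm_ge0//.
  apply: big1 => i _; have : y 0 i ^+ 2 = 0.
    apply/eqP; rewrite eq_le sqr_ge0 andbT.
    rewrite Y0 /Y (bigD1 i)//= lerDl.
    by apply: sumr_ge0 => j _; exact: sqr_ge0.
  by move/eqP; rewrite sqrf_eq0 => /eqP ->; rewrite mulr0.
rewrite pmulr_rge0// subr_ge0 => PXY.
rewrite /enorm -sqrtrM// (le_trans (ler_norm _))//.
by rewrite -sqrtr_sqr ler_wsqrtr.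
Qed.

Lemma ler_enormD x y : enorm (x + y) <= enorm x + enorm y.
Proof.
rewrite -[leRHS]ger0_norm ?addr_ge0 ?enorm_ge0// -sqrtr_sqr ler_wsqrtr//.
rewrite sqrrD !sqr_sqrtr ?sum_sqr_ge0//.
rewrite (eq_bigr (fun i => x 0 i ^+ 2 + x 0 i * y 0 i *+ 2 + y 0 i ^+ 2)).
  rewrite !big_split/= lerD2r lerD2l mulr2n.
  by apply: lerD; exact: cauchy_schwarz_rV.
by move=> i _; rewrite mxE sqrrD.
Qed.

Lemma convex_enorm_powR (p : R) : 1 <= p ->
  convex_function [set: convex_lmodType 'rV[R]_n] (fun z => enorm z `^ p).
Proof.
move=> p1; apply/convex_functionP => t x y t01.
have /andP[t0 t1] := t01; have p0 : 0 <= p by rewrite (le_trans _ p1).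
have t'0 : 0 <= 1 - t by rewrite subr_ge0.
apply: (@le_trans _ _ ((t * enorm x + (1 - t) * enorm y) `^ p)).
  apply: ge0_ler_powR => //; rewrite ?nnegrE ?enorm_ge0//.
    by rewrite addr_ge0// mulr_ge0// enorm_ge0.
  by rewrite (le_trans (ler_enormD _ _))// !enormZ !ger0_norm.
have := @convex_powR R p p1 (Itv01 t0 t1) (enorm x) (enorm y).
by rewrite !inE/= !in_itv/= !enorm_ge0 => /(_ isT isT).
Qed.

Lemma measurable_enorm : measurable_fun setT (@enorm R n).
Proof.
apply: (@measurableT_comp _ _ _ _ _ _ (@Num.sqrt R)).
  exact: continuous_measurable_fun (@sqrt_continuous R).
by apply: measurable_sum => i; apply: measurable_funX; exact: measurable_mx_entry.
Qed.

Lemma measurable_enorm_powR d (T : measurableType d) (p : R) (g : T -> 'rV[R]_n) :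
  measurable_fun setT g -> measurable_fun setT (fun t => (enorm (g t) `^ p)%:E).
Proof.
move=> mg; apply/measurable_EFinP.
apply: (measurableT_comp (@measurable_powR R p)).
by apply: (measurableT_comp measurable_enorm).
Qed.

End euclidean_norm.

(** * Boxes and compact sets *)

Section boxes.
Context {R : realType}.

Definition box n (r : R) : set 'rV[R]_n :=
  [set a | forall i, `[- r, r]%classic (a 0 i)].

Lemma measurable_rV_box n (B : 'I_n -> set R) : (forall i, measurable (B i)) ->
  measurable [set a : 'rV[R]_n | forall i, B i (a 0 i)].
Proof.
move=> mB.
rewrite (_ : mkset _ = \bigcap_(i in setT) ((fun a : 'rV[R]_n => a 0 i) @^-1` B i)).
  apply: fin_bigcap_measurable => // i _.
  by rewrite -[X in measurable X]setTI; exact: measurable_mx_entry.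
by apply/seteqP; split => [a aB i _|a aB i]; exact: aB.
Qed.

Lemma measurable_box n r : measurable (@box n r).
Proof. exact: (@measurable_rV_box n (fun=> `[- r, r]%classic)). Qed.

Lemma compact_box n r : compact (@box n r).
Proof.
apply: (@rV_compact R n (fun=> `[- r, r]%classic)) => _.
exact: segment_compact.
Qed.

Lemma measurable_Q1 n : measurable (@Q1 R n).
Proof.
rewrite (_ : @Q1 R n = [set a | forall i, `]0, 1[%classic (a 0 i)]).
  exact: (@measurable_rV_box n (fun=> `]0, 1[%classic)).
by apply/seteqP; split => a aQ i; have := aQ i; rewrite /= in_itv.
Qed.

Lemma compact_sub_box n (K : set 'rV[R]_n) : compact K ->
  exists2 r, 0 <= r & K `<=` box r.
Proof.
move=> /compact_bounded[M [_ KM]]; exists (Num.max M 0 + 1).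
  by rewrite addr_ge0// le_max lexx orbT.
move=> a Ka i; rewrite /= in_itv/= -ler_norml.
have aM : `|a| <= Num.max M 0 + 1.
  by apply: KM Ka; rewrite (@le_lt_trans _ _ (Num.max M 0)) ?le_max ?lexx// ltrDl.
apply: le_trans aM; rewrite /Num.norm/= mx_normrE.
by apply: (le_trans _ (le_bigmax _ _ (0, i))).
Qed.

(** The sets are arbitrary: the integral of a nonnegative function is a supremum
over simple functions below it, whether or not it is measurable.  Compact sets
can thus be replaced by boxes without showing that they are measurable. *)
Lemma ge0_le_integral_set d (T : measurableType d)
    (mu : {measure set T -> \bar R}) (A B : set T) (f : T -> \bar R) :
  (forall x, (0 <= f x)%E) -> A `<=` B ->
  (\int[mu]_(x in A) f x <= \int[mu]_(x in B) f x)%E.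
Proof.
move=> f0 AB; rewrite !ge0_integralE//; apply: ge_ereal_sup => _ [h hA <-].
apply: ereal_sup_ubound; exists h => // x /=; rewrite (le_trans (hA x))//.
rewrite !patchE; case: ifPn => [/set_mem/AB/mem_set ->//|_].
by case: ifPn.
Qed.

End boxes.

(** * Means over vertical segments *)

Section vertical_mean.
Context {R : realType} {d m : nat}.
Implicit Types (u : Rd R d -> 'rV[R]_m) (p : R).

(** The factor [2^-1] is the inverse of the length of [(-1, 1)].  Where some entry
is not integrable on the fibre the value is arbitrary. *)
Definition vmean u (a : 'rV[R]_d.-1) : 'rV[R]_m :=
  \row_i (2^-1 * \int[lebesgueR]_(s in Iunit) u (a, s) 0 i)%R.

Definition vertically_integrable u (a : 'rV[R]_d.-1) :=
  forall i, lebesgueR.-integrable (@Iunit R) (fun s => (u (a, s) 0 i)%:E).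

Lemma measurable_Iunit : measurable (@Iunit R).
Proof. exact: measurable_itv. Qed.

Lemma lebesgueR_Iunit : lebesgueR (@Iunit R) = 2%:E.
Proof.
rewrite /lebesgueR /Iunit lebesgue_measure_itv/= ifT.
  by rewrite -EFinB; congr EFin; ring.
by rewrite lte_fin; lra.
Qed.

Let mI := measurable_Iunit.

Lemma measurable_vertical u (a : 'rV[R]_d.-1) :
  measurable_fun setT u -> measurable_fun setT (fun s => u (a, s)).
Proof. by move=> mu; apply: (measurableT_comp mu). Qed.

Lemma measurable_vmean u : measurable_fun setT u -> measurable_fun setT (vmean u).
Proof.
move=> mu; apply: measurable_fun_mx => i j.
apply: (eq_measurable_fun (fun a => 2^-1 *
    fine (\int[lebesgueR]_(s in Iunit) (u (a, s) 0 j)%:E)%E)).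
  by move=> a _; rewrite mxE.
apply: measurable_funM => //; apply: (measurableT_comp (fine_measurable measurableT)) => //.
pose g (z : Rd R d) := (u z 0 j)%:E.
have mg : measurable_fun setT g; first rewrite /g.
  by apply/measurable_EFinP; exact: (measurableT_comp (measurable_mx_entry 0 j) mu).
rewrite (_ : (fun a => _) = (fun a =>
    \int[lebesgueR]_(s in Iunit) (g^\+)%E (a, s) -
    \int[lebesgueR]_(s in Iunit) (g^\-)%E (a, s))%E); last first.
  apply/funext => a; rewrite integralE.
  by congr (_ - _)%E; apply: eq_integral => s _; rewrite ?funeposE ?funenegE.
apply: emeasurable_funB.
- apply: (measurable_ge0_integral_section lebesgueR mI (f := fun a s => (g^\+)%E (a, s))) => //.
    rewrite (_ : (fun _ => _) = (g^\+)%E); last by apply/funext => -[].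
    exact: measurable_funepos.
- apply: (measurable_ge0_integral_section lebesgueR mI (f := fun a s => (g^\-)%E (a, s))) => //.
    rewrite (_ : (fun _ => _) = (g^\-)%E); last by apply/funext => -[].
    exact: measurable_funeneg.
Qed.

(** Tonelli on each compact set [box N * [-1, 1]], followed by a countable union
over [N]. *)
Lemma ae_vertical_Lp p u : Lploc_Rd p u ->
  {ae lebesgue_rV R d.-1, forall a,
    (\int[lebesgueR]_(s in Iunit) (enorm (u (a, s)) `^ p)%:E < +oo)%E}.
Proof.
move=> [mu uLp].
have mup : measurable_fun setT (fun z : Rd R d => (enorm (u z) `^ p)%:E).
  exact: measurable_enorm_powR.
have up0 (z : Rd R d) : (0 <= (enorm (u z) `^ p)%:E)%E by rewrite lee_fin powR_ge0.
pose G a := (\int[lebesgueR]_(s in Iunit) (enorm (u (a, s)) `^ p)%:E)%E.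
have mG : measurable_fun setT G.
  apply: (measurable_ge0_integral_section lebesgueR mI
    (f := fun a s => (enorm (u (a, s)) `^ p)%:E)) => //.
  by apply: eq_measurable_fun mup => -[].
have G0 a : (0 <= G a)%E by exact: integral_ge0.
have : {ae lebesgue_rV R d.-1, forall a, forall N : nat, box N%:R a -> G a \is a fin_num}.
  apply: ae_foralln => N; apply: integrable_ae; first exact: measurable_box.
  apply/integrableP; split; first exact: measurable_funS mG.
  under eq_integral => a _ do rewrite gee0_abs//.
  rewrite -(ge0_integral_setX (lebesgue_rV R d.-1) lebesgueR
    (f := fun z => (enorm (u z) `^ p)%:E))//; last exact: measurable_box.
  apply: le_lt_trans (uLp (box N%:R `*` `[-1, 1]%classic) _).
    apply: ge0_le_integral_set => // -[a s] [/= aN].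
    rewrite /Iunit/= !in_itv/= => /andP[s1 s2].
    by split => //=; rewrite ?in_itv/= !ltW.
  by apply: compact_setX; [exact: compact_box|exact: segment_compact].
apply: filterS => a Ga; rewrite -[ltLHS]/(G a) -ge0_fin_numE//.
have [r r0 ar] := compact_sub_box (@compact_set1 _ a).
apply: (Ga (Num.bound r)) => i; have := ar a erefl i.
rewrite /= !in_itv/= -!ler_norml => /le_trans; apply.
exact/ltW/archi_boundP.
Qed.

(** On a segment of finite length [L^p] is contained in [L^1], because
[r <= 1 + r ^ p] for [r >= 0]. *)
Lemma vertically_integrable_Lp p u a : 1 <= p -> measurable_fun setT u ->
  (\int[lebesgueR]_(s in Iunit) (enorm (u (a, s)) `^ p)%:E < +oo)%E ->
  vertically_integrable u a.
Proof.
move=> p1 mu uLp i.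
have mua := measurable_vertical a mu.
have up0 s : (0 <= (enorm (u (a, s)) `^ p)%:E)%E by rewrite lee_fin powR_ge0.
apply: (@le_integrable _ _ _ lebesgueR _ mI _
  (fun s => 1%:E + (enorm (u (a, s)) `^ p)%:E)%E) => //.
- apply/measurable_EFinP; apply: measurable_funTS.
  exact: (measurableT_comp (measurable_mx_entry 0 i) mua).
- move=> s _; rewrite lee_fin [leRHS]ger0_norm ?addr_ge0 ?powR_ge0//.
  rewrite (le_trans (ler_entry_enorm _ _))//.
  have [e1|e1] := leP (enorm (u (a, s))) 1; first by rewrite (le_trans e1)// lerDl powR_ge0.
  rewrite (@le_trans _ _ (enorm (u (a, s)) `^ p)) ?lerDr//.
  rewrite -[leLHS]powRr1 ?enorm_ge0// ler_powR// ltW//.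
- apply: integrableD => //.
    apply/integrableP; split; first exact: measurable_cst.
    rewrite (eq_integral (cst 1%:E)); last by move=> s _; rewrite /= normr1.
    by rewrite integral_cst// [X in (_ * X)%E]lebesgueR_Iunit -EFinM ltry.
  apply/integrableP; split.
    by apply: measurable_funTS; exact: measurable_enorm_powR.
  by under eq_integral => s _ do rewrite gee0_abs//.
Qed.

Lemma jensen_vmean u a (phi : 'rV[R]_m -> R) :
  measurable_fun setT u -> vertically_integrable u a ->
  convex_function [set: convex_lmodType 'rV[R]_m] phi ->
  (forall z, 0 <= phi z) -> measurable_fun setT phi ->
  (2%:E * (phi (vmean u a))%:E
    <= \int[lebesgueR]_(s in Iunit) (phi (u (a, s)))%:E)%E.
Proof.
move=> mu iu cphi phi0 mphi; rewrite -EFinM.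
apply: (jensen_rV mI _ lebesgueR_Iunit cphi phi0 iu) => //.
apply: measurable_funTS; apply: (measurableT_comp mphi).
exact: measurable_vertical.
Qed.

(** Jensen's inequality for the convex function [enorm z `^ p] on almost every
fibre. *)
Lemma vmean_Lploc p u : 1 <= p -> Lploc_Rd p u -> Lploc_rV p (vmean u).
Proof.
move=> p1 uLp; have [mu uoo] := uLp; split; first exact: measurable_vmean.
move=> K /compact_sub_box[r r0 Kr].
have mup : measurable_fun setT (fun z : Rd R d => (enorm (u z) `^ p)%:E).
  exact: measurable_enorm_powR.
have up0 (z : Rd R d) : (0 <= (enorm (u z) `^ p)%:E)%E by rewrite lee_fin powR_ge0.
apply: le_lt_trans (uoo (box r `*` `[-1, 1]%classic) _); last first.
  by apply: compact_setX; [exact: compact_box|exact: segment_compact].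
apply: (@le_trans _ _ (\int[lebesgue_Rd R d]_(z in box r `*` Iunit)
    (enorm (u z) `^ p)%:E)%E); last first.
  apply: ge0_le_integral_set => // -[a s] [/= aN].
  rewrite /Iunit/= !in_itv/= => /andP[s1 s2].
  by split => //=; rewrite ?in_itv/= !ltW.
apply: (@le_trans _ _ (\int[lebesgue_rV R d.-1]_(a in box r)
    (enorm (vmean u a) `^ p)%:E)%E).
  by apply: ge0_le_integral_set => // a; rewrite lee_fin powR_ge0.
rewrite (ge0_integral_setX (lebesgue_rV R d.-1) lebesgueR
    (f := fun z => (enorm (u z) `^ p)%:E))//; last exact: measurable_box.
apply: ae_ge0_le_integral.
- exact: measurable_box.
- by move=> a _; rewrite lee_fin powR_ge0.
- by apply: measurable_funTS; apply: measurable_enorm_powR; exact: measurable_vmean.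
- by move=> a _; exact: integral_ge0.
- apply: measurable_funTS; apply: (measurable_ge0_integral_section lebesgueR mI
    (f := fun a s => (enorm (u (a, s)) `^ p)%:E)) => //.
  by apply: eq_measurable_fun mup => -[].
apply: filterS (ae_vertical_Lp uLp) => a uap _.
have ia := vertically_integrable_Lp p1 mu uap.
apply: (le_trans _ (jensen_vmean mu ia (convex_enorm_powR p1) _ _)).
- by rewrite -EFinM lee_fin ler_peMl ?powR_ge0// ler1n.
- by move=> z; exact: powR_ge0.
- by apply: (measurableT_comp (@measurable_powR R p)); exact: measurable_enorm.
Qed.

(** For almost every [a] the identity [u (a + k, s) = u (a, s) + M k] holds for
almost every [s], and can be averaged in [s]. *)
Lemma vmean_Dper p M u : 1 <= p -> Dper p M u -> Dper_alpha p M (vmean u).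
Proof.
move=> p1 [uLp uper]; split; first exact: vmean_Lploc.
have [mu _] := uLp.
move=> k.
have := ae_sf_product (uper k).
have := ae_vertical_Lp uLp.
apply: filterS2 => a uap uk.
have ia := vertically_integrable_Lp p1 mu uap.
pose c := (zvec k : 'rV[R]_d.-1) *m M^T.
have uak : {ae lebesgueR, forall s, u (a + zvec k, s) = u (a, s) + c}.
  apply: filterS uk => s.
  have -> : (a, s) + (zvec k, 0) = (a + zvec k, s) :> Rd R d.
    exact: (congr2 pair erefl (addr0 s)).
  rewrite /= mulmxDl -/c => /eqP.
  by rewrite subr_eq addrA subrK => /eqP.
suff -> : vmean u (a + zvec k) = vmean u a + c.
  by rewrite mulmxDl -/c opprD addrA addrAC addrK.
have mui b i : measurable_fun (@Iunit R) (fun s => u (b, s) 0 i).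
  apply: measurable_funTS.
  exact: (measurableT_comp (measurable_mx_entry 0 i) (measurable_vertical b mu)).
have icst (r : R) : lebesgueR.-integrable (@Iunit R) (EFin \o cst r).
  apply/integrableP; split; first exact/measurable_EFinP/measurable_cst.
  rewrite (eq_integral (cst `|r|%:E)); last by [].
  by rewrite integral_cst// [X in (_ * X)%E]lebesgueR_Iunit -EFinM ltry.
apply/rowP => i; rewrite !mxE.
have -> : \int[lebesgueR]_(s in Iunit) u (a + zvec k, s) 0 i =
    \int[lebesgueR]_(s in Iunit) (u (a, s) 0 i + cst (c 0 i) s).
  congr fine; apply: ae_eq_integral => //.
  - exact/measurable_EFinP.
  - by apply/measurable_EFinP; apply: measurable_funD.
  - by apply: filterS uak => s /= -> _; rewrite mxE.
rewrite RintegralD//; last exact: ia.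
rewrite [X in _ + X]Rintegral_cst// [X in fine X]lebesgueR_Iunit/=.
by rewrite mulrDr mulrCA mulVf// mulr1 mxE.
Qed.

End vertical_mean.

(** * The cell energy in terms of pairs of vertical segments *)

Section cell_energy.
Context {R : realType} {d m : nat}.
Variable f : Rd R d -> Rd R d -> 'rV[R]_m -> R.
Hypotheses (f0 : forall x xi z, 0 <= f x xi z) (mf : borel3 f).

Lemma measurable_integrand (u : Rd R d -> 'rV[R]_m) dT (T : measurableType dT)
    (a b : T -> 'rV[R]_d.-1) (s t : T -> R) :
  measurable_fun setT u -> measurable_fun setT a -> measurable_fun setT b ->
  measurable_fun setT s -> measurable_fun setT t ->
  measurable_fun setT
    (fun x => f (a x, 0) (b x, 0) (u (a x + b x, t x) - u (a x, s x))).
Proof.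
move=> mu ma mb ms mt.
have mabt : measurable_fun setT (fun x => u (a x + b x, t x)).
  apply: (measurableT_comp mu); apply: measurable_fun_pair => //.
  apply: measurable_fun_mx => i j.
  apply: (eq_measurable_fun (fun x => a x i j + b x i j)).
    by move=> x _; rewrite mxE.
  by apply: measurable_funD; apply: (measurableT_comp (measurable_mx_entry i j)).
have mas : measurable_fun setT (fun x => u (a x, s x)).
  by apply: (measurableT_comp mu); exact: measurable_fun_pair.
pose g x : (Rd R d * Rd R d) * 'rV[R]_m :=
  (((a x, 0), (b x, 0)), u (a x + b x, t x) - u (a x, s x)).
suff mg : measurable_fun setT g by exact: (measurableT_comp mf mg).
apply: measurable_fun_pair.
  by apply: measurable_fun_pair; exact: measurable_fun_pair.
apply: measurable_fun_mx => i j.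
apply: (eq_measurable_fun (fun x => u (a x + b x, t x) i j - u (a x, s x) i j)).
  by move=> x _; rewrite !mxE.
by apply: measurable_funB; apply: (measurableT_comp (measurable_mx_entry i j)).
Qed.

(** The interaction energy of the vertical segments over [a] and [a + b]. *)
Definition fibre_energy (u : Rd R d -> 'rV[R]_m) a b : \bar R :=
  (\int[lebesgueR]_(s in Iunit) \int[lebesgueR]_(t in Iunit)
    (f (a, 0%R) (b, 0%R) (u ((a + b)%R, t) - u (a, s))%R)%:E)%E.

Lemma fibre_energy_ge0 u a b : (0 <= fibre_energy u a b)%E.
Proof. by apply: integral_ge0 => s _; apply: integral_ge0 => t _; rewrite /= lee_fin. Qed.

Lemma measurable_fibre_energy u dT (T : measurableType dT) (a b : T -> 'rV[R]_d.-1) :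
  measurable_fun setT u -> measurable_fun setT a -> measurable_fun setT b ->
  measurable_fun setT (fun x => fibre_energy u (a x) (b x)).
Proof.
move=> mu ma mb; apply: (measurable_ge0_integral_section _ _
  (f := fun x s => \int[lebesgueR]_(t in Iunit)
    (f (a x, 0) (b x, 0) (u ((a x + b x)%R, t) - u (a x, s)))%:E)%E).
- exact: measurable_Iunit.
- apply: (measurable_ge0_integral_section _ _ (f := fun (z : T * R) t =>
    (f (a z.1, 0) (b z.1, 0) (u (a z.1 + b z.1, t) - u (a z.1, z.2)))%:E)).
  + exact: measurable_Iunit.
  + apply/measurable_EFinP; apply: (measurable_integrand
      (a := fun y : (T * R) * R => a y.1.1) (b := fun y => b y.1.1)
      (s := fun y => y.1.2) (t := fun y => y.2)) => //.
    * apply: (measurableT_comp ma).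
      exact: (measurableT_comp measurable_fst measurable_fst).
    * apply: (measurableT_comp mb).
      exact: (measurableT_comp measurable_fst measurable_fst).
    * exact: (measurableT_comp measurable_snd measurable_fst).
    * exact: measurable_snd.
  + by move=> z t; rewrite /= lee_fin.
- by move=> x s; apply: integral_ge0 => t _; rewrite /= lee_fin.
Qed.

(** The domain [I1 xi_d] depends on [xi_d].  Coding it, together with the height
of the first point, by indicator functions makes all domains of integration
products; the integral in [xi_d] can then be moved inside and shifted by [s]. *)
Lemma cell_energyE (u : Rd R d -> 'rV[R]_m) : measurable_fun setT u ->
  (\int[lebesgue_Rd R d]_xi \int[lebesgue_Rd R d]_(x in @Q1 R d.-1 `*` I1 xi.2)
     (f (horizontal x) (horizontal xi) (u (x + xi) - u x)%R)%:E =
   \int[lebesgue_rV R d.-1]_b \int[lebesgue_rV R d.-1]_(a in @Q1 R d.-1)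
     fibre_energy u a b)%E.
Proof.
move=> mu.
have mQ1 := @measurable_Q1 R d.-1.
(* The increment [xi] is [(b, t)] and the first point [x] is [(a, s)]. *)
pose H (b : 'rV[R]_d.-1) (t : R) (a : 'rV[R]_d.-1) (s : R) : \bar R :=
  (f (a, 0) (b, 0) (u (a + b, s + t) - u (a, s))
   * (\1_(@Iunit R) s * \1_(@Iunit R) (s + t)))%:E.
have H0 b t a s : (0 <= H b t a s)%E by rewrite lee_fin !mulr_ge0.
have mH dT (T : measurableType dT) (b a : T -> 'rV[R]_d.-1) (t s : T -> R) :
    measurable_fun setT b -> measurable_fun setT t ->
    measurable_fun setT a -> measurable_fun setT s ->
    measurable_fun setT (fun x => H (b x) (t x) (a x) (s x)).
  move=> mb mt ma ms; apply/measurable_EFinP.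
  have mst : measurable_fun setT (fun x => s x + t x) by exact: measurable_funD.
  have mI : measurable_fun setT (\1_(@Iunit R) : R -> R).
    by apply: measurable_indic; exact: measurable_Iunit.
  apply: measurable_funM; first exact: measurable_integrand.
  by apply: measurable_funM; [exact: (measurableT_comp mI ms)
                            |exact: (measurableT_comp mI mst)].
transitivity (\int[lebesgue_Rd R d]_(xi in setT `*` setT)
    \int[lebesgue_Rd R d]_(x in @Q1 R d.-1 `*` setT) H xi.1 xi.2 x.1 x.2)%E.
  rewrite setXTT; apply: eq_integral => -[b t] _.
  rewrite integral_mkcond [RHS]integral_mkcond; apply: eq_integral => -[a s] _.
  rewrite !patchE !in_setX in_setT andbT /= /H !indicE.
  case: ifPn => [/andP[-> /set_mem[sI stI]]|].
    by rewrite !mem_set// !mulr1.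
  case: (boolP (a \in @Q1 R d.-1)) => //= _ /negP sI.
  case: (boolP (s \in Iunit)) => /= [/set_mem s1|_]; last by rewrite mul0r mulr0.
  case: (boolP (s + t \in Iunit)) => /= [/set_mem s2|_]; last by rewrite !mulr0.
  by exfalso; apply: sI; apply/mem_set.
rewrite ge0_integral_setX//; last 2 first.
- apply: (measurable_ge0_integral_section _ _
    (f := fun xi x : Rd R d => H xi.1 xi.2 x.1 x.2)) => //.
  + exact: measurableX.
  + exact: (mH _ _ _ _ _ _
      (measurableT_comp measurable_fst measurable_fst)
      (measurableT_comp measurable_snd measurable_fst)
      (measurableT_comp measurable_fst measurable_snd)
      (measurableT_comp measurable_snd measurable_snd)).
- by move=> xi; exact: integral_ge0.
apply: eq_integral => b _ /=.
transitivity (\int[lebesgueR]_t \int[lebesgue_rV R d.-1]_(a in @Q1 R d.-1)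
    \int[lebesgueR]_s H b t a s)%E.
  apply: eq_integral => t _.
  rewrite ge0_integral_setX//.
  exact: (mH _ _ (fun=> b) _ (fun=> t) _ (measurable_cst b) (measurable_cst t)
    measurable_fst measurable_snd).
transitivity (\int[lebesgue_rV R d.-1]_(a in @Q1 R d.-1)
    \int[lebesgueR]_t \int[lebesgueR]_s H b t a s)%E.
  apply: (ge0_integral_exchange lebesgueR (lebesgue_rV R d.-1) measurableT mQ1
    (f := fun t a => \int[lebesgueR]_s H b t a s)%E).
    apply: (measurable_ge0_integral_section lebesgueR measurableT
      (f := fun (z : R * 'rV[R]_d.-1) s => H b z.1 z.2 s)) => //.
    exact: (mH _ _ (fun=> b) _ _ _ (measurable_cst b)
      (measurableT_comp measurable_fst measurable_fst)
      (measurableT_comp measurable_snd measurable_fst) measurable_snd).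
  by move=> t a; exact: integral_ge0.
apply: eq_integral => a _.
transitivity (\int[lebesgueR]_s \int[lebesgueR]_t H b t a s)%E.
  apply: (ge0_integral_exchange lebesgueR lebesgueR measurableT measurableT
    (f := fun t s => H b t a s)) => //.
  exact: (mH _ _ (fun=> b) (fun=> a) _ _ (measurable_cst b) measurable_fst
    (measurable_cst a) measurable_snd).
rewrite /fibre_energy [RHS]integral_mkcond; apply: eq_integral => s _.
(* From here on [t] is the height of the second point. *)
pose G (t : R) : \bar R :=
  (f (a, 0) (b, 0) (u (a + b, t) - u (a, s)) * (\1_(@Iunit R) s * \1_(@Iunit R) t))%:E.
transitivity (\int[lebesgueR]_t G (t + s)%R)%E.
  by apply: eq_integral => t _; rewrite /H /G (addrC s).
rewrite ge0_integral_translation; last 2 first.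
- rewrite (_ : G = fun t => H b (t - s) a s).
    apply: (mH _ R (fun=> b) (fun=> a) (fun t => t - s) (fun=> s)) => //.
    exact: measurable_funB.
  by apply/funext => t; rewrite /G /H (addrC s (t - s)) subrK.
- by move=> t; rewrite lee_fin !mulr_ge0.
rewrite patchE /G indicE; case: ifPn => sI.
  rewrite [RHS]integral_mkcond; apply: eq_integral => t _.
  by rewrite patchE indicE; case: ifPn => _; rewrite mul1r ?mulr1 ?mulr0.
by apply: integral0_eq => t _; rewrite mul0r mulr0.
Qed.

End cell_energy.

(** * Comparison with the horizontal energy *)

Section vertical_averaging.
Context {R : realType} {d m : nat}.
Variable f : Rd R d -> Rd R d -> 'rV[R]_m -> R.
Hypotheses (f0 : forall x xi z, 0 <= f x xi z) (mf : borel3 f).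

Lemma fibre_energy_fst (w : 'rV[R]_d.-1 -> 'rV[R]_m) a b :
  (fibre_energy f (fun x => w x.1) a b =
   4%:R%:E * (f (a, 0%R) (b, 0%R) (w (a + b)%R - w a)%R)%:E)%E.
Proof.
rewrite /fibre_energy/=; set c := f _ _ _.
have -> : (\int[lebesgueR]_(t in @Iunit R) c%:E)%E = (c * 2)%:E.
  rewrite integral_cst; last exact: measurable_Iunit.
  by rewrite [X in (_ * X)%E]lebesgueR_Iunit.
rewrite integral_cst; last exact: measurable_Iunit.
rewrite [X in (_ * X)%E]lebesgueR_Iunit -!EFinM; congr EFin; ring.
Qed.

(** Both uses of Jensen's inequality are on a segment of length 2, for the convex
functions [z |-> f (a, b, z - u (a, s))] and
[z |-> f (a, b, vmean u (a + b) - z)]. *)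
Lemma le_fibre_energy_vmean (u : Rd R d -> 'rV[R]_m) a b :
  convex_function [set: convex_lmodType 'rV[R]_m] (f (a, 0) (b, 0)) ->
  measurable_fun setT u ->
  vertically_integrable u a -> vertically_integrable u (a + b) ->
  (4%:R%:E * (f (a, 0%R) (b, 0%R) (vmean u (a + b)%R - vmean u a)%R)%:E
    <= fibre_energy f u a b)%E.
Proof.
move=> cf mu ia iab; have mI := @measurable_Iunit R.
have mfz : measurable_fun setT (f (a, 0) (b, 0)).
  pose g (z : 'rV[R]_m) : (Rd R d * Rd R d) * 'rV[R]_m := (((a, 0), (b, 0)), z).
  have mg : measurable_fun setT g by exact: measurable_fun_pair.
  exact: (measurableT_comp mf mg).
have maff (y : 'rV[R]_m) (k : R) :
    measurable_fun setT (fun z : 'rV[R]_m => f (a, 0) (b, 0) (y + k *: z)).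
  apply: (measurableT_comp mfz); apply: measurable_fun_mx => i j.
  apply: (eq_measurable_fun (fun z : 'rV[R]_m => y i j + k * z i j)).
    by move=> z _; rewrite !mxE.
  by apply: measurable_funD => //; apply: measurable_funM => //; exact: measurable_mx_entry.
have inner s : (2%:E * (f (a, 0%R) (b, 0%R) (vmean u (a + b)%R - u (a, s))%R)%:E <=
    \int[lebesgueR]_(t in Iunit)
      (f (a, 0%R) (b, 0%R) (u ((a + b)%R, t) - u (a, s))%R)%:E)%E.
  have := jensen_vmean mu iab
    (convex_function_affine (- u (a, s)) 1 cf) (fun z => f0 _ _ _) (maff _ 1).
  rewrite scale1r addrC; congr (_ <= _)%E; apply: eq_integral => t _.
  by rewrite scale1r addrC.
have outer := jensen_vmean mu ia
    (convex_function_affine (vmean u (a + b)) (- 1) cf) (fun z => f0 _ _ _)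
    (maff _ (- 1)).
rewrite scaleN1r in outer.
apply: (@le_trans _ _ (2%:E * \int[lebesgueR]_(s in Iunit)
    (f (a, 0%R) (b, 0%R) (vmean u (a + b)%R + - 1 *: u (a, s))%R)%:E)%E).
  rewrite (_ : 4%:R = 2 * 2 :> R); last by ring.
  by rewrite EFinM -muleA; apply: lee_wpmul2l.
have mua : measurable_fun (@Iunit R)
    (fun s => (f (a, 0) (b, 0) (vmean u (a + b) + -1 *: u (a, s)))%:E).
  apply/measurable_EFinP; apply: measurable_funTS.
  exact: (measurableT_comp (maff _ _) (measurable_vertical a mu)).
rewrite -ge0_integralZl//; last by move=> s _; rewrite lee_fin.
apply: ge0_le_integral => //.
- by move=> s _; rewrite -EFinM lee_fin mulr_ge0.
- exact: measurable_funeM.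
- apply: measurable_funTS; apply: (measurable_ge0_integral_section lebesgueR mI
    (f := fun s t => (f (a, 0) (b, 0) (u (a + b, t) - u (a, s)))%:E)) => //.
    apply/measurable_EFinP; exact: (measurable_integrand mf mu (measurable_cst a)
      (measurable_cst b) measurable_fst measurable_snd).
  by move=> s t; rewrite lee_fin.
- by move=> s _; rewrite scaleN1r; exact: inner.
Qed.

(** A compact set lies in a product of a box and a segment, over which the
integral is a finite multiple of the horizontal one. *)
Lemma Dper_fst (p : R) (M : 'M[R]_(m, d.-1)) (w : 'rV[R]_d.-1 -> 'rV[R]_m) :
  Dper_alpha p M w -> Dper p M (fun x => w x.1).
Proof.
move=> [[mw wLp] wper]; split; last first.
  by move=> k; exact: (ae_sf_product_fst (@lebesgueR R) (wper k)).
have mw1 : measurable_fun setT (fun x : Rd R d => w x.1).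
  exact: (measurableT_comp mw measurable_fst).
split => // K cK.
have /compact_sub_box[r r0 Kr] : compact (fst @` K).
  by apply: continuous_compact => //; apply: continuous_subspaceT => x; exact: cvg_fst.
have /compact_bounded[N [_ KN]] : compact (snd @` K).
  by apply: continuous_compact => //; apply: continuous_subspaceT => x; exact: cvg_snd.
pose q := Num.max N 0 + 1.
have wp0 a : (0 <= (enorm (w a) `^ p)%:E)%E by rewrite lee_fin powR_ge0.
have KQ : K `<=` box r `*` `[- q, q]%classic.
  move=> x Kx; split; first by apply: Kr; exists x.
  rewrite /= in_itv/= -ler_norml; apply: (KN q); last by exists x.
  by rewrite /q (@le_lt_trans _ _ (Num.max N 0)) ?le_max ?lexx// ltrDl.
apply: (le_lt_trans (ge0_le_integral_set (lebesgue_Rd R d) _ KQ)).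
  by move=> x; exact: wp0.
rewrite (ge0_integral_setX (lebesgue_rV R d.-1) lebesgueR
    (f := fun z => (enorm (w z.1) `^ p)%:E))//; last 2 first.
- exact: measurable_box.
- exact: measurable_enorm_powR.
rewrite /=; under eq_integral => a _ do rewrite integral_cst//.
have qlty : (lebesgueR `[(- q)%R, q]%classic < +oo)%E.
  by rewrite /lebesgueR lebesgue_measure_itv/=; case: ifP; rewrite ?ltry// -EFinB ltry.
rewrite ge0_integralZr//; last 2 first.
- exact: measurable_box.
- by apply: measurable_funTS; exact: measurable_enorm_powR.
by rewrite lte_mul_pinfty// ?integral_ge0// ge0_fin_numE ?integral_ge0// wLp//; exact: compact_box.
Qed.

End vertical_averaging.

Theorem proposition6p4 (R : realType) (d m : nat) (p : R)
  (f : Rd R d -> Rd R d -> 'rV[R]_m -> R) (gamma : R -> R) :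
  (2 <= d)%N -> (1 <= m)%N -> 1 < p ->
  (forall x xi z, 0 <= f x xi z) ->
  borel3 f ->
  periodic1 f ->
  growth p f ->
  vertically_independent f ->
  horizontally_convex f ->
  (forall e, 0 < e < 1 -> 0 < gamma e < 1) ->
  (e / gamma e @[e --> 0^'+] --> +oo) ->
  forall M : 'M[R]_(m, d.-1),
    (fhom_infty p f M =
     4%:R%:E * ereal_inf [set
       \int[lebesgue_rV R d.-1]_b \int[lebesgue_rV R d.-1]_(a in @Q1 R d.-1)
         (f (a, 0%R) (b, 0%R) (w (a + b)%R - w a)%R)%:E
       | w in Dper_alpha p M])%E.
Proof.
move=> _ _ p1 f0 mf _ _ _ cf _ _ M.
have mQ1 := @measurable_Q1 R d.-1.
(* The constant 4 is kept inside the integrals, where the bounds on the fibre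
   energies produce it. *)
pose E (w : 'rV[R]_d.-1 -> 'rV[R]_m) :=
  (\int[lebesgue_rV R d.-1]_b \int[lebesgue_rV R d.-1]_(a in @Q1 R d.-1)
    (4%:R%:E * (f (a, 0%R) (b, 0%R) (w (a + b)%R - w a)%R)%:E))%E.
have mw dT (T : measurableType dT) (w : 'rV[R]_d.-1 -> 'rV[R]_m)
    (a b : T -> 'rV[R]_d.-1) : measurable_fun setT w ->
    measurable_fun setT a -> measurable_fun setT b ->
    measurable_fun setT (fun x => (f (a x, 0) (b x, 0) (w (a x + b x) - w (a x)))%:E).
  move=> wm ma mb; apply/measurable_EFinP.
  have w1m : measurable_fun setT (fun x : Rd R d => w x.1).
    exact: (measurableT_comp wm measurable_fst).
  exact: (measurable_integrand mf w1m ma mb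
    (measurable_cst (0 : R)) (measurable_cst (0 : R))).
have EE w : measurable_fun setT w -> (E w = 4%:R%:E *
    \int[lebesgue_rV R d.-1]_b \int[lebesgue_rV R d.-1]_(a in @Q1 R d.-1)
         (f (a, 0%R) (b, 0%R) (w (a + b)%R - w a)%R)%:E)%E.
  move=> wm; rewrite -ge0_integralZl//; last 2 first.
  - apply: (measurable_ge0_integral_section _ mQ1 (f := fun b a =>
      (f (a, 0) (b, 0) (w (a + b) - w a))%:E)) => //.
      exact: (mw _ _ _ _ _ wm measurable_snd measurable_fst).
    by move=> b a; rewrite lee_fin.
  - by move=> b _; apply: integral_ge0 => a _; rewrite lee_fin.
  apply: eq_integral => b _; rewrite -ge0_integralZl//.
  - apply: measurable_funTS.
    exact: (mw _ 'rV[R]_d.-1 _ id (fun=> b)).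
  - by move=> a _; rewrite lee_fin.
rewrite -ereal_inf_pZl//; apply/eqP; rewrite eq_le; apply/andP; split.
- apply: le_ereal_inf_tmp => _ [_ [w wM <-] <-].
  have wm : measurable_fun setT w by case: wM => -[].
  rewrite -EE//; apply: ereal_inf_lbound.
  exists (fun x => w x.1); first exact: Dper_fst.
  rewrite cell_energyE//; last exact: (measurableT_comp wm measurable_fst).
  by apply: eq_integral => b _; apply: eq_integral => a _; exact: fibre_energy_fst.
- apply: le_ereal_inf_tmp => _ [u uM <-].
  have [[mu _] _] := uM; have uLp := uM.1.
  have wM := vmean_Dper (ltW p1) uM; have wm := measurable_vmean mu.
  rewrite cell_energyE//; apply: ge_ereal_inf.
  exists (E (vmean u)).
    by rewrite EE//; eexists; [exists (vmean u) => //|].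
  have iu : {ae lebesgue_rV R d.-1, forall a, vertically_integrable u a}.
    apply: filterS (ae_vertical_Lp uLp) => a.
    by apply: vertically_integrable_Lp => //; exact: ltW.
  apply: ge0_le_integral => //.
  + by move=> b _; apply: integral_ge0 => a _; rewrite -EFinM lee_fin mulr_ge0.
  + apply: (measurable_ge0_integral_section _ mQ1 (f := fun b a =>
      (4%:R%:E * (f (a, 0) (b, 0) (vmean u (a + b)%R - vmean u a)%R)%:E)%E)) => //.
      apply: measurable_funeM.
      exact: (mw _ _ _ _ _ wm measurable_snd measurable_fst).
    by move=> b a; rewrite -EFinM lee_fin mulr_ge0.
  + apply: (measurable_ge0_integral_section _ mQ1
      (f := fun b a => fibre_energy f u a b)) => //.
      exact: (measurable_fibre_energy f0 mf mu measurable_snd measurable_fst).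
    by move=> b a; exact: fibre_energy_ge0.
  move=> b _; apply: ae_ge0_le_integral => //.
  + by move=> a _; rewrite -EFinM lee_fin mulr_ge0.
  + apply: measurable_funTS; apply: measurable_funeM.
    exact: (mw _ 'rV[R]_d.-1 _ id (fun=> b)).
  + by move=> a _; exact: fibre_energy_ge0.
  + apply: measurable_funTS.
    exact: (measurable_fibre_energy f0 mf (a := id) (b := fun=> b) mu).
  apply: filterS2 iu (ae_rV_translation b iu) => a ia iab _.
  exact: le_fibre_energy_vmean.
Qed.
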